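(* Every sequentially compact strongly monolithic topological space is $\omega_1$-sequentially compact. In particular, Corson compacta and any Eberlein compacta defined from adequate families are $\omega_1$-sequentially compact.
   Context: A space $X$ is strongly monolithic if the weight of $\overline{A}$ does not exceed $|A|$ for every $A\subseteq X$. A compact space is Eberlein compact if it embeds homeomorphically into a Banach space with its weak topology. A compact space is Corson compact if it embeds homeomorphically into $\Sigma(\kappa)=\{f\in\mathbb{R}^\kappa:|\{\alpha\in\kappa:f(\alpha)\neq0\}|\leq\omega\}$ (with the product topology) for some $\kappa$. A family $\mathcal{D}\subseteq\mathcal{P}(Y)$ is adequate if it is closed under subsets and $D\in\mathcal{D}$ if and only if every finite subset of $D$ is in $\mathcal{D}$; it defines the compact space $K_{\mathcal{D}}=\{1_D:D\in\mathcal{D}\}\subseteq 2^Y$ of characteristic functions. An Eberlein compactum defined from an adequate family is a space of the form $K_{\mathcal{D}}$, $\mathcal{D}$ adequate, that is Eberlein compact. For sets of naturals, $s\sqsubseteq t$ means $s$ is an initial segment of $t$. For $\mathcal{F}\subseteq[\omega]^{<\omega}$ and $M\subseteq\omega$ let $\mathcal{F}|M=\{s\in\mathcal{F}:s\subseteq M\}$. A barrier on an infinite set $M\subseteq\omega$ is a family $\mathcal{B}$ of finite subsets of $M$ such that (a) $s\subseteq t$ implies $s=t$ for $s,t\in\mathcal{B}$, and (b) every infinite $N\subseteq M$ has an initial segment $s\sqsubseteq N$ with $s\in\mathcal{B}$. Every barrier has a rank: $T(\mathcal{B})=\{s\in[\omega]^{<\omega}:\exists t\in\mathcal{B}\,(s\sqsubseteq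 t)\}$, $\rho_{T(\mathcal{B})}(s)=\sup\{\rho_{T(\mathcal{B})}(t)+1:t\in T(\mathcal{B}),\ s\sqsubseteq t,\ s\neq t\}$ (with $\sup\emptyset=0$), and $\rho(\mathcal{B})=\rho_{T(\mathcal{B})}(\emptyset)<\omega_1$. If $\mathcal{B}$ is a barrier on an infinite set $M$, $f:\mathcal{B}\to X$ converges to $x\in X$ if for every open $U\ni x$ there is $n\in\omega$ with $f[\mathcal{B}|(M\setminus n)]\subseteq U$. For a barrier $\mathcal{B}$ on $\omega$, $X$ is $\mathcal{B}$-sequentially compact if for every $f:\mathcal{B}\to X$ there is an infinite $M\subseteq\omega$ such that $f\restriction(\mathcal{B}|M)$ converges to some point of $X$. For $\alpha<\omega_1$, $X$ is $\alpha$-sequentially compact if it is $\mathcal{B}$-sequentially compact for all barriers $\mathcal{B}$ on $\omega$ of rank $\alpha$; $X$ is $\omega_1$-sequentially compact if it is $\alpha$-sequentially compact for every $\alpha<\omega_1$. *)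

(* Defs.v *)
From HB Require Import structures.
From mathcomp Require Import all_boot all_order all_algebra finmap.
From mathcomp Require Import all_classical all_reals all_analysis.

Set Implicit Arguments.
Unset Strict Implicit.
Unset Printing Implicit Defensive.

Import Order.TTheory GRing.Theory Num.Theory.
Import numFieldNormedType.Exports.

Local Open Scope classical_set_scope.
Local Open Scope card_scope.

Definition sequentially_compact (X : topologicalType) : Prop :=
  forall u : nat -> X, exists phi : nat -> nat,
    {homo phi : m n / (m < n)%N} /\ exists x : X, (u \o phi) @ \oo --> x.

(* The weight of [closure A] is the least cardinality of a basis of the
   subspace [closure A] (whose topology is that of the subtype, not that of
   [subspace]); it is at most [#|A|] iff some basis has cardinality at most
   that of [A]. *)
Definition strongly_monolithic (X : topologicalType) : Prop :=
  forall A : set X,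
    exists2 B : set (set (set_type (closure A))), basis B & (B #<= A).

Definition homeomorphic_embedding (X Y : topologicalType) (e : X -> Y) : Prop :=
  [/\ injective e, continuous e &
      forall U : set X, open U ->
        exists2 W : set Y, open W & e @` U = range e `&` W].

Definition embeds (X Y : topologicalType) : Prop :=
  exists e : X -> Y, homeomorphic_embedding e.

Definition continuous_functional (R : realType) (V : normedModType R) : Type :=
  {f : {scalar V} | continuous (f : V -> R)}.

(* [V] with the coarsest topology making all the continuous functionals
   continuous. *)
Definition weak_space (R : realType) (V : normedModType R) : topologicalType :=
  sup_topology (fun f : continuous_functional V =>
    Topological.class (initial_topology (sval f : V -> R))).

Definition eberlein_compact (R : realType) (X : topologicalType) : Prop :=
  compact [set: X] /\
  exists V : completeNormedModType R, embeds X (weak_space V).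

Definition Sigma_product (R : realType) (kappa : Type) :
    set {ptws kappa -> R} :=
  [set f | countable [set a | f a != 0%R]].

Definition corson_compact (R : realType) (X : topologicalType) : Prop :=
  compact [set: X] /\
  exists kappa : Type, embeds X (set_type (@Sigma_product R kappa)).

Definition adequate (Y : Type) (D : set (set Y)) : Prop :=
  (forall A B : set Y, D A -> B `<=` A -> D B) /\
  (forall A : set Y,
    D A <-> forall F : set Y, finite_set F -> F `<=` A -> D F).

Definition char_fun (Y : Type) (A : set Y) : {ptws Y -> bool} :=
  fun y => `[< A y >].

Definition adequate_space (Y : Type) (D : set (set Y)) : topologicalType :=
  set_type [set char_fun A | A in D].

Definition initial_segment (s t : set nat) : Prop :=
  s `<=` t /\ forall i j : nat, s i -> t j -> (j <= i)%N -> s j.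

Definition fam_restr (F : set {fset nat}) (M : set nat) : set {fset nat} :=
  [set s | F s /\ [set` s] `<=` M].

Definition barrier (M : set nat) (B : set {fset nat}) : Prop :=
  [/\ forall s, B s -> [set` s] `<=` M,
      forall s t, B s -> B t -> (s `<=` t)%fset -> s = t &
      forall N : set nat, infinite_set N -> N `<=` M ->
        exists2 s, B s & initial_segment [set` s] N].

(* Notations for the ordinals below omega_1: every countable ordinal is denoted
   by some term ([osup f] is the supremum of the [f n], not necessarily a
   limit), and [a] and [b] denote the same ordinal iff [ole a b] and
   [ole b a]. *)
Inductive cord : Type :=
| ozero : cord
| osucc : cord -> cord
| osup : (nat -> cord) -> cord.

Inductive ole : cord -> cord -> Prop :=
| ole_zero b : ole ozero b
| ole_succ a b : ole a b -> ole (osucc a) (osucc b)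
| ole_sup_least f b : (forall n, ole (f n) b) -> ole (osup f) b
| ole_sup_upper a f n : ole a (f n) -> ole a (osup f).

Definition is_osup (A : set cord) (b : cord) : Prop :=
  (forall a, A a -> ole a b) /\
  (forall c, (forall a, A a -> ole a c) -> ole b c).

Definition barrier_tree (B : set {fset nat}) : set {fset nat} :=
  [set s | exists2 t, B t & initial_segment [set` s] [set` t]].

Definition tree_ext (T : set {fset nat}) (t s : {fset nat}) : Prop :=
  [/\ T t, initial_segment [set` s] [set` t] & s <> t].

Definition rank_function (T : set {fset nat}) (rho : {fset nat} -> cord) : Prop :=
  forall s, is_osup [set osucc (rho t) | t in [set t | tree_ext T t s]] (rho s).

(* As [is_osup] determines the notation [rho s] only up to [ole] both ways,
   this is invariant under replacing [alpha] by another notation for the same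
   ordinal. *)
Definition barrier_rank (B : set {fset nat}) (alpha : cord) : Prop :=
  exists2 rho, rank_function (barrier_tree B) rho & rho fset0 = alpha.

(* For a barrier [B] on [M]; only the values of [f] on [B] matter. *)
Definition barrier_cvg (X : topologicalType) (M : set nat)
    (B : set {fset nat}) (f : {fset nat} -> X) (x : X) : Prop :=
  forall U : set X, open U -> U x ->
    exists n : nat, f @` fam_restr B (M `\` `I_n) `<=` U.

Definition barrier_sequentially_compact (B : set {fset nat})
    (X : topologicalType) : Prop :=
  forall f : {fset nat} -> X, exists M : set nat,
    infinite_set M /\ exists x : X, barrier_cvg M (fam_restr B M) f x.

Definition ord_sequentially_compact (alpha : cord) (X : topologicalType) :
    Prop :=
  forall B : set {fset nat}, barrier [set: nat] B -> barrier_rank B alpha ->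
    barrier_sequentially_compact B X.

Definition omega1_sequentially_compact (X : topologicalType) : Prop :=
  forall alpha : cord, ord_sequentially_compact alpha X.

Lemma ole_refl a : ole a a.
Proof.
elim: a => [|a IH|f IH]; [exact: ole_zero|exact: ole_succ|].
by apply: ole_sup_least => n; apply: (ole_sup_upper (n := n)).
Qed.

Lemma barrier_tree_wf B : barrier [set: nat] B ->
  well_founded (tree_ext (barrier_tree B)).
Proof.
move=> [_ Banti Bseg] s0; apply: contrapT => nAcc0.
set E := tree_ext _ in nAcc0.
have step (s : {s | ~ Acc E s}) : exists t : {s | ~ Acc E s}, E (sval t) (sval s).
  case: s => s /= ns; apply: contrapT => nex; apply: ns; constructor=> t Ets.
  by apply: contrapT => nt; apply: nex; exists (exist _ t nt).
have [g gE] := choice step.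
pose c n := sval (iter n g (exist _ s0 nAcc0)).
have cE n : E (c n.+1) (c n) by exact: gE.
have cS m n : (m <= n)%N -> (c m `<=` c n)%fset.
  elim: n => [|n IH]; first by rewrite leqn0 => /eqP ->.
  rewrite leq_eqVlt => /predU1P[-> //|/IH mn].
  apply: (fsubset_trans mn); apply/fsubsetP => i.
  by case: (cE n) => _ [+ _] _; exact.
have card_c n : (n <= #|` c n|)%N.
  elim: n => // n IH; apply: (leq_ltn_trans IH); apply: fproper_ltn_card.
  by rewrite fproperEneq cS // andbT; apply/eqP; case: (cE n).
pose N := \bigcup_n [set` c n].
have Ninf : infinite_set N.
  move=> /finite_fsetP[F NF]; have := card_c #|` F|.+1.
  apply/negP; rewrite -ltnNge ltnS; apply: fsubset_leq_card.
  apply/fsubsetP => i ic; have : N i by exists #|` F|.+1.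
  by rewrite NF.
have [b Bb [bN _]] := Bseg N Ninf (@subsetT _ _).
have bN' (i : nat) : exists n, i \in b -> i \in c n.
  case: (boolP (i \in b)) => [ib|]; last by exists 0.
  by have [n _ icn] := bN i ib; exists n.
have [h hP] := choice bN'.
pose n := (\max_(i <- b) h i)%N.
have bc : (b `<=` c n)%fset.
  apply/fsubsetP => i ib; apply: (fsubsetP (cS (h i) n _)); last exact: hP.
  exact: leq_bigmax_seq.
have [[t Bt [ct _]] [_ _] ncc] := cE n.
have ctS : (c n.+1 `<=` t)%fset by apply/fsubsetP => i; exact: ct.
have cn1 := cS n n.+1 (leqnSn n).
have bt : b = t.
  exact: (Banti _ _ Bb Bt (fsubset_trans bc (fsubset_trans cn1 ctS))).
apply: ncc; apply/eqP; rewrite eqEfsubset cn1 /=.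
by apply: (fsubset_trans ctS); rewrite -bt.
Qed.

Lemma barrier_has_rank B : barrier [set: nat] B ->
  exists alpha, barrier_rank B alpha.
Proof.
move=> /barrier_tree_wf wf; set T := barrier_tree B in wf *.
pose step s (rec : forall t, tree_ext T t s -> cord) : cord :=
  osup (fun n => if @choice.unpickle {fset nat} n is Some t then
    if pselect (tree_ext T t s) is left Ets then osucc (rec t Ets) else ozero
  else ozero).
pose rho := Fix wf (fun=> cord) step.
have rhoE s : rho s = step s (fun t _ => rho t).
  rewrite /rho Fix_eq // => x f g fg; congr (step x _).
  by apply/functional_extensionality_dep => t; apply/functional_extensionality_dep.
exists (rho fset0), rho => // s; rewrite rhoE; split=> [_ [t Ets <-]|c cub].
  apply: (ole_sup_upper (n := choice.pickle t)); rewrite choice.pickleK.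
  by case: pselect => // _; exact: ole_refl.
apply: ole_sup_least => n; case: choice.unpickle => [t|]; last exact: ole_zero.
by case: pselect => [Ets|_]; [apply: cub; exists t|exact: ole_zero].
Qed.

(* Main.v *)
From HB Require Import structures.
Require Import Defs.
From mathcomp Require Import all_boot all_order all_algebra finmap.
From mathcomp Require Import all_classical all_reals all_analysis.

(* Let [f] map a barrier [B] to [X].  The Nash-Williams theorem and a fusion
   give, for any countable family of subsets of [X], an infinite [M] such that
   each set of the family either contains or misses [f s] for all [s] in [B|M]
   far enough out in [M].  When the family is rich enough at a cluster point [x]
   of these values, [f] converges to [x] along [M].
   - If [X] is sequentially compact and strongly monolithic, the traces of a
     countable basis of the closure of the countable range of [f] form such a
     family, and [x] is a limit of a sequence of values of [f].
   - If [X] is a compact subspace of a Sigma-product, the values of [f] have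
     supports in a common countable set, and the preimages of rational intervals
     under the corresponding coordinates form such a family.
   - If [K_D] is Eberlein compact for an adequate family [D], then all members
     of [D] are countable, so that [K_D] lies in a Sigma-product: the function
     [1_A] is in the closure of the [1_F] with [F] a finite subset of [A], and
     by Kaplansky's theorem the weak topology of a normed space is countably
     tight, so that countably many such [F] suffice, and these cover [A]. *)

Set Implicit Arguments.
Unset Strict Implicit.
Unset Printing Implicit Defensive.

Import Order.TTheory GRing.Theory Num.Theory.
Import numFieldNormedType.Exports.

Local Open Scope classical_set_scope.
Local Open Scope card_scope.

(** * The Nash-Williams theorem *)

Lemma infinite_natP (A : set nat) :
  infinite_set A <-> forall n, exists2 m, A m & (n <= m)%N.
Proof.
split=> [iA n|Aunb /finite_fsetP[F AF]].
  have [|m [Am nm]] := @infinite_setN0 _ (A `\` `I_n).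
    exact/(infinite_setD iA)/finite_II.
  by exists m => //; rewrite leqNgt; apply/negP.
have [m Am Fm] := Aunb (\max_(i <- F) i).+1%N.
have mF : m \in F by move: Am; rewrite AF.
have : (m <= \max_(i <- F) i)%N by exact: leq_bigmax_seq.
by rewrite leqNgt Fm.
Qed.

Lemma set_nat_min (A : set nat) : A !=set0 ->
  exists2 m, A m & forall i, A i -> (m <= i)%N.
Proof.
move=> [a Aa]; have ex : exists n, `[< A n >] by exists a; exact/asboolP.
case: (ex_minnP ex) => m /asboolP Am mmin; exists m => // i Ai.
by apply: mmin; exact/asboolP.
Qed.

Definition tail (M : set nat) (k : nat) : set nat := M `&` [set i | (k < i)%N].

Lemma infinite_tail k M : infinite_set M -> infinite_set (tail M k).
Proof.
move=> /infinite_natP iM; apply/infinite_natP => n.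
have [m Mm] := iM (maxn n k.+1); rewrite geq_max => /andP[nm km].
by exists m.
Qed.

Definition hereditary (P : set (set nat)) :=
  forall M M' : set nat, M' `<=` M -> P M -> P M'.

Definition dense_below (P : set (set nat)) :=
  forall N : set nat, infinite_set N ->
    exists M, [/\ infinite_set M, M `<=` N & P M].

(** Diagonalization: from [S i], with least element [k i], pass to an infinite [S i.+1] inside
    [tail (S i) (k i)] that satisfies [P (k i)]. In the range of [k], everything beyond [k i] lies
    in [S i.+1], so heredity gives the condition. *)
Lemma fusion (P : nat -> set (set nat)) :
  (forall k, hereditary (P k)) -> (forall k, dense_below (P k)) ->
  dense_below [set M | forall k, M k -> P k (tail M k)].
Proof.
move=> Pher Pdense N0 iN0.
pose infset := {N : set nat | infinite_set N}.
have mP (N : infset) : exists m, sval N m /\ forall i, sval N i -> (m <= i)%N.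
  by have [m ? ?] := set_nat_min (infinite_setN0 (proj2_sig N)); exists m.
have [mn mnP] := choice mP.
have gP (N : infset) : exists M : infset,
    sval M `<=` tail (sval N) (mn N) /\ P (mn N) (sval M).
  have [M [iM MN PM]] :=
    Pdense (mn N) _ (infinite_tail (k := mn N) (proj2_sig N)).
  by exists (exist _ M iM).
have [g gE] := choice gP.
pose S i := iter i g (exist _ N0 iN0 : infset).
pose k i := mn (S i).
have SS i j : (i <= j)%N -> sval (S j) `<=` sval (S i).
  elim: j => [|j IH]; first by rewrite leqn0 => /eqP ->.
  rewrite leq_eqVlt => /predU1P[-> //|/IH]; apply: subset_trans.
  by apply: (subset_trans (gE _).1) => x [].
have kS i j : (i < j)%N -> sval (S i.+1) (k j).
  by move=> ij; apply: (SS _ _ ij); exact: (mnP _).1.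
have kmono i j : (i < j)%N -> (k i < k j)%N.
  by move=> /kS /(gE (S i)).1[].
have ki i : (i <= k i)%N.
  by elim: i => // i IH; apply: (leq_ltn_trans IH); exact: kmono.
exists (range k); split.
- by apply/infinite_natP => n; exists (k n).
- by move=> _ [i _ <-]; apply: (SS 0%N i) => //; exact: (mnP _).1.
- move=> _ [i _ <-]; apply: (Pher _ _ _ _ (gE (S i)).2) => _ [[j _ <-] /= kij].
  apply: kS; rewrite ltnNge; apply: contraTN kij; rewrite -leqNgt.
  by rewrite leq_eqVlt => /predU1P[->//|/kmono/ltnW].
Qed.

(** Lets a fusion meet at stage [k] all conditions with index up to [k] at once. *)
Lemma dense_below_ltn (P : nat -> set (set nat)) :
  (forall k, hereditary (P k)) -> (forall k, dense_below (P k)) ->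
  forall n, dense_below [set M | forall k, (k < n)%N -> P k M].
Proof.
move=> Pher Pdense; elim=> [N iN|n IH N iN]; first by exists N; split.
have [M [iM MN PM]] := IH N iN.
have [M' [iM' M'M PM']] := Pdense n M iM.
exists M'; split=> //; first exact: subset_trans MN.
move=> k; rewrite ltnS leq_eqVlt => /predU1P[->//|/PM].
exact: Pher.
Qed.

Definition homogeneous_above (B : set {fset nat}) (C : set {fset nat})
    (s : {fset nat}) (M : set nat) :=
  exists c : bool, forall t, B t -> initial_segment [set` s] [set` t] ->
    [set` t] `\` [set` s] `<=` M -> (C t <-> c).

Lemma hereditary_homogeneous_above B C s : hereditary (homogeneous_above B C s).
Proof.
move=> M M' M'M [c cP]; exists c => t Bt st tM'.
by apply: cP => //; exact: subset_trans M'M.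
Qed.

Lemma infinite_set_split (M : set nat) (c : nat -> bool) : infinite_set M ->
  exists b, infinite_set (M `&` [set i | c i = b]).
Proof.
move=> iM; apply: contrapT => /forallNP nb; apply: iM.
have -> : M = \bigcup_b (M `&` [set i | c i = b]).
  by apply/seteqP; split=> [i Mi|i [b _ []//]]; exists (c i).
apply: bigcup_finite => [|b _]; [exact: finite_finset|].
by apply: contrapT; exact: nb.
Qed.

(** Well-founded induction along the tree of [B], from the end nodes down to the empty set. Above
    [s], a fusion handles all one-point end-extensions of [s], and the pigeonhole principle then
    makes their colours agree. *)
Lemma Nash_Williams (B C : set {fset nat}) : barrier [set: nat] B ->
  dense_below [set M | fam_restr B M `<=` C \/ fam_restr B M `<=` ~` C].
Proof.
move=> bB; have wf := barrier_tree_wf bB; case: bB => _ Banti _.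
suff H s : dense_below (homogeneous_above B C s).
  move=> N iN; have [M [iM MN [c cP]]] := H fset0 N iN.
  exists M; split=> //.
  have {}cP t : fam_restr B M t -> (C t <-> c).
    by move=> [Bt tM]; apply: cP => // i [+ _]; exact: tM.
  by case: c cP => cP; [left|right] => t /cP [Ct tC]; [exact: tC|move=> /Ct].
elim/(well_founded_ind wf): s => s IH N iN.
(* If [s] is in [B], it is the only member of [B] above [s], as [B] is an antichain. *)
have [Bs|nBs] := pselect (B s).
  exists N; split=> //; exists `[< C s >] => t Bt [st _] _.
  rewrite (Banti _ _ Bs Bt); first by split=> /asboolP.
  by apply/fsubsetP => i; exact: st.
pose m := (\max_(i <- s) i)%N.
have sm i : i \in s -> (i <= m)%N by move=> si; exact: leq_bigmax_seq.
have dense k : (m < k)%N -> dense_below (homogeneous_above B C (k |` s)%fset).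
  move=> mk.
  have [Ts|nTs] := pselect (barrier_tree B (k |` s)%fset).
    apply: IH; split=> //.
      split=> [i|i j si]; first by rewrite /= in_fsetU => ->; rewrite orbT.
      rewrite /= in_fsetU in_fset1 => /predU1P[->|//] ki.
      by have := leq_trans mk (leq_trans ki (sm i si)); rewrite ltnn.
    move=> sE; have : k \in s by rewrite sE in_fsetU in_fset1 eqxx.
    by move=> /sm; rewrite leqNgt mk.
  (* No member of [B] lies above a set outside the tree, so any colour will do. *)
  move=> M iM; exists M; split=> //; exists true => t Bt st _.
  by exfalso; apply: nTs; exists t.
pose P k := [set M | (m < k)%N -> homogeneous_above B C (k |` s)%fset M].
have Pher k : hereditary (P k).
  move=> M M' M'M PM mk.
  by apply: (hereditary_homogeneous_above M'M); exact: PM.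
have Pdense k : dense_below (P k).
  have [mk|km] := ltnP m k; last first.
    by move=> M iM; exists M; split=> //; rewrite /P /= ltnNge km.
  by move=> M /(dense k mk)[M' [? ? ?]]; exists M'; split=> // _.
have [M [iM MN PM]] := fusion Pher Pdense (infinite_tail (k := m) iN).
have cP k : exists c : bool, M k -> forall t, B t ->
    initial_segment [set` (k |` s)%fset] [set` t] ->
    [set` t] `\` [set` (k |` s)%fset] `<=` tail M k -> (C t <-> c).
  have [Mk|nMk] := pselect (M k); last by exists true.
  by have [|c cP] := PM k Mk; [have [] := MN k Mk|exists c].
have [c {}cP] := choice cP.
have [b ib] := infinite_set_split c iM.
exists (M `&` [set i | c i = b]); split=> //; first by move=> i [/MN[]].
exists b => t Bt [st sS] tsM.
have [|k [tk nsk] kmin] := @set_nat_min ([set` t] `\` [set` s]).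
  apply: contrapT => /set0P/negP/negPn/eqP ts0; apply: nBs.
  suff -> : s = t by [].
  apply/fsetP => i; apply/idP/idP => [/st//|ti]; apply: contrapT => nsi.
  by have : (set0 : set nat) i; [rewrite -ts0|].
have [Mk /= <-] := tsM k (conj tk nsk).
apply: (cP k Mk t Bt).
- split=> [i|i j]; first by rewrite /= in_fsetU in_fset1 => /predU1P[->|/st].
  rewrite /= !in_fsetU !in_fset1 => /predU1P[->|si] tj ji.
    apply/orP; have [|nsj] := boolP (j \in s); [by right|left].
    by rewrite eqn_leq ji kmin //; split=> //=; exact/negP.
  by apply/orP; right; exact: (sS i).
- move=> i [/= ti]; rewrite in_fsetU in_fset1 => /negP; rewrite negb_or.
  move=> /andP[ik /negP nsi]; have [Mi _] := tsM i (conj ti nsi).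
  by split=> //=; rewrite ltn_neqAle eq_sym ik kmin.
Qed.

(** * Convergence along barriers *)

(** Recasts [barrier_cvg] as convergence of a filter, which makes cluster points and compactness
    available. *)
Definition barrier_filter (X : Type) (M : set nat) (B : set {fset nat})
    (f : {fset nat} -> X) : set_system X :=
  [set U | exists n, f @` fam_restr B (M `\` `I_n) `<=` U].

Section barrier_filter.
Variables (X : topologicalType) (B : set {fset nat}) (f : {fset nat} -> X).
Hypothesis bB : barrier [set: nat] B.

Lemma barrier_nonempty (M : set nat) : infinite_set M ->
  fam_restr B M !=set0.
Proof.
case: bB => _ _ seg iM; have [s Bs [sM _]] := seg M iM (@subsetT _ _).
by exists s.
Qed.

Lemma barrier_filter_proper (M : set nat) : infinite_set M ->
  ProperFilter (barrier_filter M (fam_restr B M) f).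
Proof.
move=> iM; apply: Build_ProperFilter_ex => [U [n nU]|].
  have [s [Bs sM]] := barrier_nonempty (infinite_setD iM (finite_II n)).
  by exists (f s); apply: nU; exists s => //; split=> //; split=> // i /sM[].
split=> [|U V [m mU] [n nV]|U V UV [n nU]]; first by exists 0%N.
- exists (maxn m n) => _ [s [Bs sM] <-]; split; [apply: mU|apply: nV];
    exists s => //; split=> // i /sM [Mi /= /negP]; rewrite -leqNgt geq_max;
    by move=> /andP[mi ni]; split=> //=; apply/negP; rewrite -leqNgt.
- by exists n; apply: subset_trans UV.
Qed.

Lemma barrier_filter_cvg (M : set nat) (x : X) :
  barrier_filter M (fam_restr B M) f --> x ->
  barrier_cvg M (fam_restr B M) f x.
Proof. by move=> Fx U oU Ux; apply: Fx; exact: open_nbhs_nbhs. Qed.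

Lemma barrier_filter_decides (VV : set (set X)) : countable VV ->
  exists2 M, infinite_set M & forall V, VV V ->
    barrier_filter M (fam_restr B M) f V \/
    barrier_filter M (fam_restr B M) f (~` V).
Proof.
move=> /countable_injP[g ginj].
pose P k := [set M | forall V, VV V -> g V = k ->
  fam_restr B M `<=` f @^-1` V \/ fam_restr B M `<=` ~` (f @^-1` V)].
have sub M M' : M' `<=` M -> fam_restr B M' `<=` fam_restr B M.
  by move=> M'M s [Bs sM']; split=> //; exact: subset_trans M'M.
have Pher k : hereditary (P k).
  move=> M M' /sub M'M PM V VVV gV.
  by case: (PM V VVV gV) => h; [left|right]; exact: subset_trans h.
have Pdense k : dense_below (P k).
  have [[V [VVV gV]]|nV] := pselect (exists V, VV V /\ g V = k).
    move=> N /(Nash_Williams (f @^-1` V) bB)[M [iM MN h]].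
    exists M; split=> // W VVW gW.
    by have -> : W = V; [apply: ginj; rewrite ?inE ?gV|].
  by move=> N iN; exists N; split=> // V VVV gV; case: nV; exists V.
(* The conditions are cumulative: for [k] in [M], the set [tail M k] satisfies [P j] for every
   [j <= k]. Hence any [k] in [M] with [g V <= k] serves for [V]. *)
have [] := fusion (P := fun k => [set M | forall j, (j < k.+1)%N -> P j M])
  _ _ infinite_nat.
- by move=> k M M' M'M PM j jk; apply: (Pher _ _ _ M'M); exact: PM.
- by move=> k; exact: dense_below_ltn.
move=> M [iM _ PM]; exists M => // V VVV.
have /infinite_natP/(_ (g V))[k Mk gVk] := iM.
have tl : fam_restr (fam_restr B M) (M `\` `I_k.+1) `<=` fam_restr B (tail M k).
  move=> s [[Bs _] sM]; split=> // i /sM[Mi /= /negP]; rewrite -leqNgt.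
  by split.
by case: (PM k Mk (g V) gVk V VVV erefl) => h; [left|right];
  exists k.+1 => _ [s /tl/h fs <-].
Qed.

End barrier_filter.

Lemma decided_cluster (X : topologicalType) (F : set_system X) (V : set X) x :
  Filter F -> cluster F x -> nbhs x V -> F V \/ F (~` V) -> F V.
Proof.
move=> FF Fx xV [//|FV]; have [y [nVy Vy]] := Fx _ _ FV xV.
by case: nVy.
Qed.

Lemma countable_image (S T : Type) (A : set S) (g : S -> T) :
  countable A -> countable (g @` A).
Proof. by apply: sub_countable; exact: card_image_le. Qed.

Lemma monolithic_omega1_sequentially_compact (X : topologicalType) :
  sequentially_compact X -> strongly_monolithic X ->
  omega1_sequentially_compact X.
Proof.
move=> scX smX alpha B bB _ f.
(* There are only countably many finite sets of naturals, so [range f] is countable and [Q] is a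
   countable basis of its closure. *)
have [Q [Qopen Qbase] QA] := smX (range f).
have cQ : countable Q.
  exact: sub_countable QA (countable_image _ (countableP _)).
have [M iM dec] := barrier_filter_decides f bB
  (countable_image (fun V => set_val @` V) cQ).
exists M; split=> //; pose F := barrier_filter M (fam_restr B M) f.
have FP : ProperFilter F by exact: barrier_filter_proper.
(* One member of [B] beyond each [n] gives a sequence of values of [f] that eventually enters every
   set of [F]; the limit of a subsequence is the candidate [x]. *)
have /choice[s sP] n : exists s, fam_restr B (M `\` `I_n) s.
  exact: (barrier_nonempty bB (infinite_setD iM (finite_II n))).
have [phi [phimono [x fx]]] := scX (f \o s).
have phige n : (n <= phi n)%N.
  by elim: n => // n IH; apply: (leq_ltn_trans IH); exact: phimono.
have sF U : F U -> \forall n \near \oo, U ((f \o s \o phi) n).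
  move=> [m mU]; exists m => // n /= mn; apply: mU; exists (s (phi n)) => //.
  have [Bs sM] := sP (phi n); split; first by split=> // i /sM[].
  move=> i /sM[Mi /= ni]; split=> //= im; apply: ni.
  exact: leq_trans im (leq_trans mn (phige n)).
have clx : closure (range f) x.
  move=> U /fx [m _ mU]; exists (f (s (phi m))).
  by split; [exists (s (phi m))|exact: (mU m (leqnn m))].
exists x; apply: barrier_filter_cvg => U xU.
pose x' : closure (range f) := SigSub (mem_set clx).
have : nbhs x' (set_val @^-1` U).
  by apply: (@initial_continuous _ _ (@set_val _ (closure (range f)))).
move=> /Qbase[V [QV Vx'] /= VU].
have [W oW WV] := Qopen V QV.
have [|FV] := dec _ (imageP (fun V => set_val @` V) QV).
  by apply: filterS => _ [y Vy <-]; exact: VU.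
have xW : nbhs x W.
  by apply: open_nbhs_nbhs; split=> //; move: Vx'; rewrite -WV.
(* If [F] contained the complement of [V], the subsequence would eventually miss [V]; but it is
   eventually in [W], whose trace on the closure is [V]. *)
have [n [+ Wn]] := filter_ex (filterI (sF _ FV) (fx _ xW)).
move=> nV; exfalso; apply: nV.
have cl : closure (range f) (f (s (phi n))).
  by apply: subset_closure; exists (s (phi n)).
by exists (SigSub (mem_set cl)) => //; rewrite -WV.
Qed.

(** * Compacta with countable supports *)

(** Together [econt] and [einit] say that [X] has the initial topology of its coordinates, so
    convergence to a cluster point is checked at each coordinate: by decided sets on the countable
    union [C] of the supports, by constancy off [C]. *)
Lemma compact_countable_support_omega1_sequentially_compact
    (X T : topologicalType) (kappa : Type) (e : X -> kappa -> T) (t0 : T) :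
  @second_countable T -> accessible_space T -> compact [set: X] ->
  (forall a, continuous (e ^~ a)) ->
  (forall (F : set_system X) x, Filter F ->
    (forall a, (e ^~ a) @ F --> e x a) -> F --> x) ->
  (forall x, countable [set a | e x a <> t0]) ->
  omega1_sequentially_compact X.
Proof.
move=> [Q cQ [Qopen Qbase]] T1 cptX econt einit esupp alpha B bB _ f.
pose C := \bigcup_(s in [set: {fset nat}]) [set a | e (f s) a <> t0].
have cC : countable C by apply: bigcup_countable => // s _; exact: esupp.
have [M iM dec] := barrier_filter_decides f bB
  (countable_image (fun p => e ^~ p.1 @^-1` p.2) (countableX cC cQ)).
exists M; split=> //; pose F := barrier_filter M (fam_restr B M) f.
have FP : ProperFilter F by exact: barrier_filter_proper.
have [x [_ Fx]] := cptX F FP filterT.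
exists x; apply: barrier_filter_cvg; apply: einit => a.
have [Ca|nCa] := pselect (C a).
  move=> U /Qbase[V [QV Vxa] VU].
  apply: (@filterS _ F _ ((e ^~ a) @^-1` V)); first by move=> y /VU.
  apply: decided_cluster Fx _ _.
    by apply: econt; apply: open_nbhs_nbhs; split=> //; exact: Qopen.
  by apply: dec; exists (a, V).
have Fa : F [set y | e y a = t0].
  by exists 0%N => _ [s _ <-] /=; apply: contrapT => nt0; apply: nCa; exists s.
(* Every neighbourhood of [e x a] contains [t0], as [x] is a cluster point; points of [T] are
   closed. *)
have xa : e x a = t0.
  apply: (accessible_closed_set1 T1) => U xU.
  have [y [<- Uy]] := Fx _ _ Fa (econt a x U xU).
  by exists (e y a).
apply: cvg_near_cst; rewrite xa; exact: Fa.
Qed.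

Lemma cvg_initial (S : choiceType) (T : topologicalType) (g : S -> T)
    (F : set_system S) (s : S) : Filter F ->
  g @ F --> g s -> F --> (s : initial_topology g).
Proof.
move=> FF gFs A [_ [[B oB <-] Bs BA]].
by apply: filterS BA _; apply: gFs; exact: open_nbhs_nbhs.
Qed.

Lemma cvg_ptws (I : Type) (T : topologicalType) (F : set_system {ptws I -> T})
    (h : {ptws I -> T}) : Filter F ->
  (forall i, (fun g : {ptws I -> T} => g i) @ F --> h i) -> F --> h.
Proof. by move=> FF Fh; apply/cvg_sup => i; exact: cvg_initial. Qed.

Lemma continuous_eval (I : Type) (T : topologicalType) (i : I) :
  continuous (fun g : {ptws I -> T} => g i).
Proof.
move=> g U gU; have /cvg_sup/(_ i) : nbhs g --> g by exact: cvg_id.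
by apply; exact: (@initial_continuous _ _ (fun g : {ptws I -> T} => g i)).
Qed.

Lemma continuous_set_type_eval (I : Type) (T : topologicalType)
    (A : set {ptws I -> T}) (i : I) :
  continuous (fun s : set_type A => (set_val s : {ptws I -> T}) i).
Proof.
move=> s; apply: (@continuous_comp _ _ _
  (set_val : set_type A -> {ptws I -> T}) (fun g => g i)).
  exact: initial_continuous.
exact: continuous_eval.
Qed.

Lemma cvg_set_type_ptws (I : Type) (T : topologicalType)
    (A : set {ptws I -> T}) (F : set_system (set_type A)) (s : set_type A) :
  Filter F ->
  (forall i, (fun r : set_type A => (set_val r : {ptws I -> T}) i) @ F -->
    (set_val s : {ptws I -> T}) i) -> F --> s.
Proof. by move=> FF Fs; apply: cvg_initial; apply: cvg_ptws. Qed.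

Lemma cvg_embedding (X Y : topologicalType) (e : X -> Y) (F : set_system X) x :
  homeomorphic_embedding e -> Filter F -> e @ F --> e x -> F --> x.
Proof.
move=> [einj _ eopen] FF eFx U; rewrite nbhsE => -[V [oV Vx] VU].
have [W oW VW] := eopen V oV.
have inW : (e @` V) (e x) by exists x.
apply: (@filterS _ F _ (e @^-1` W)); last first.
  apply: eFx; apply: open_nbhs_nbhs; split=> //.
  by move: inW; rewrite VW => -[].
move=> y Wy; have : (e @` V) (e y) by rewrite VW; split.
by move=> [z Vz /einj <-]; exact: VU.
Qed.

Lemma second_countable_real (R : realType) : @second_countable R.
Proof.
exists [set `]ratr p.1, ratr p.2[%classic | p in [set: rat * rat]].
  exact: countable_image.
split=> [_ [p _ <-]|x U]; first exact: interval_open.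
move=> /nbhs_ballP[e /= e0 eU].
have [p pin] : exists p : rat, (x - e < ratr p < x)%R.
  have /rat_in_itvoo[p] : (x - e < x)%R by rewrite ltrBlDr ltrDl.
  by exists p.
have [q qin] : exists q : rat, (x < ratr q < x + e)%R.
  have /rat_in_itvoo[q] : (x < x + e)%R by rewrite ltrDl.
  by exists q.
move: pin qin => /andP[ep px] /andP[xq qe].
exists `]ratr p, ratr q[%classic.
  by split; [exists (p, q)|rewrite /= in_itv /= px xq].
move=> y; rewrite /= in_itv /= => /andP[py yq].
apply: eU; rewrite /ball /= distrC ltr_distl.
by rewrite (lt_trans ep py) (lt_trans yq qe).
Qed.

Lemma second_countable_bool : @second_countable bool.
Proof.
exists [set [set b] | b in [set: bool]]; first exact: countable_image.
split=> [_ [b _ <-]|b U /nbhs_singleton Ub]; first exact: discrete_open.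
by exists [set b]; [split=> //; exists b|move=> _ ->].
Qed.

Lemma corson_compact_omega1_sequentially_compact (R : realType)
    (X : topologicalType) :
  corson_compact R X -> omega1_sequentially_compact X.
Proof.
move=> [cptX [kappa [e eemb]]].
have [_ econt _] := eemb.
apply: (@compact_countable_support_omega1_sequentially_compact X R kappa
  (fun x => set_val (e x) : kappa -> R) 0%R) => //.
- exact: second_countable_real.
- exact: hausdorff_accessible.
- move=> a x; apply: (@continuous_comp _ _ _ e
    (fun s : set_type (@Sigma_product R kappa) =>
       (set_val s : {ptws kappa -> R}) a)); first exact: econt.
  exact: continuous_set_type_eval.
- move=> F x FF Fx; apply: (cvg_embedding eemb).
  exact: cvg_set_type_ptws.
- move=> x; have := set_valP (e x); rewrite /Sigma_product /=.
  by congr (countable _); apply/seteqP; split=> a /= /eqP.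
Qed.

(** * Countable tightness of the weak topology *)

(** The section filter of the finite subsets of [A] directed by inclusion. It extracts finite sets
    from compactness below, and along it the functions [1_E] converge to [1_A]. *)
Definition finite_subsets_filter (T : Type) (A : set T) : set_system (set T) :=
  [set U | exists2 E, finite_set E /\ E `<=` A &
    forall E', finite_set E' -> E `<=` E' -> E' `<=` A -> U E'].

Lemma finite_subsets_filter_proper (T : Type) (A : set T) :
  ProperFilter (finite_subsets_filter A).
Proof.
apply: Build_ProperFilter_ex => [U [E [fE EA] UE]|].
  by exists E; exact: UE.
split=> [|U V [E [fE EA] UE] [E' [fE' E'A] VE']|U V UV [E EA UE]].
- by exists set0; first by split; [exact: finite_set0|exact: sub0set].
- exists (E `|` E'); first by split; [rewrite finite_setU|rewrite subUset].
  move=> G fG; rewrite subUset => -[EG E'G] GA.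
  by split; [exact: UE|exact: VE'].
- by exists E => // E' fE' EE' E'A; apply: UV; exact: UE.
Qed.

Lemma finite_subsets_filter_mem (T : Type) (A : set T) (a : T) : A a ->
  finite_subsets_filter A [set E | E a].
Proof.
move=> Aa; exists [set a]; first by split=> // _ ->.
by move=> E _ aE _; exact: aE.
Qed.

Section real_valued_maps.
Local Open Scope ring_scope.
Variables (R : realType) (X : topologicalType).
Implicit Types f g k : X -> R.

Lemma closed_eq_affine f g k (c : R) :
  continuous f -> continuous g -> continuous k ->
  closed [set x | f x = c * g x + k x].
Proof.
move=> fc gc kc; have -> : [set x | f x = c * g x + k x] =
    (fun x => f x - (c * g x + k x)) @^-1` [set 0].
  apply/seteqP; split=> x /= /eqP; rewrite ?subr_eq0 => /eqP -> //.
  exact: subrr.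
apply: preimage_closed.
  move=> x _; apply: cvgB; first exact: fc.
  by apply: cvgD; [apply: cvgM; [exact: cvg_cst|exact: gc]|exact: kc].
exact: accessible_closed_set1 (hausdorff_accessible (@Rhausdorff R)) _.
Qed.

Lemma near_distr_lt f g x (e : R) : continuous f -> continuous g ->
  `|f x - g x| < e -> \forall y \near x, `|f y - g y| < e.
Proof.
move=> fc gc; have : `|f y - g y| @[y --> x] --> `|f x - g x|.
  by apply: cvg_norm; apply: cvgB; [exact: fc|exact: gc].
by move=> /cvgr_lt; exact.
Qed.

End real_valued_maps.

Section weak_topology.
Local Open Scope ring_scope.
Variables (R : realType) (V : normedModType R).
Implicit Types (x y : V) (A : set V) (n : nat).
Implicit Types (fs : seq (continuous_functional V)).

Definition functional_val (f : continuous_functional V) : V -> R := sval f.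

(** Stated for all large [n], so that finitely many functionals share one bound. *)
Lemma continuous_functional_bounded (f : continuous_functional V) :
  \forall n \near \oo, forall x, `|sval f x| <= n%:R * `|x|.
Proof.
have /linear_bounded_continuous/linear_boundedP/pinfty_ex_gt0[r r0 rf] :=
  proj2_sig f : continuous (sval f : {linear V -> R^o}).
near=> n => x; apply: (le_trans (rf x)); apply: ler_wpM2r => //.
near: n; exact: nbhs_infty_ger.
Unshelve. all: by end_near. Qed.

(** Padding with the zero functional places every finite list in some [functional_ball]. *)
Definition functional_seq (fs : seq (continuous_functional V)) :
    {ptws nat * V -> R} :=
  fun p => nth 0 [seq functional_val f p.2 | f <- fs] p.1.

Definition weak_nbhs_base x : set_system V :=
  [set W | exists (fs : seq (continuous_functional V)) (e : R), 0 < e /\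
    forall y, (forall i, (i < size fs)%N ->
      `|functional_seq fs (i, y) - functional_seq fs (i, x)| < e) -> W y].

(** The system [weak_nbhs_base x] is a filter converging to [x] in the initial topology of each
    functional, hence in their supremum. *)
Lemma weak_nbhsE x (W : set V) :
  nbhs (x : weak_space V) W -> weak_nbhs_base x W.
Proof.
suff [FF Fx] :
    Filter (weak_nbhs_base x) /\ weak_nbhs_base x --> (x : weak_space V).
  exact: Fx.
have FF : Filter (weak_nbhs_base x).
  split=> [|W1 W2 [fs [e [e0 h]]] [gs [d [d0 k]]]|W1 W2 W12 [fs [e [e0 h]]]].
  - by exists [::], 1.
  - exists (fs ++ gs), (Num.min e d); split; first by rewrite lt_min e0.
    move=> y; rewrite size_cat => hy; split; [apply: h|apply: k] => i ik.
      have := hy i.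
      rewrite /functional_seq /= !map_cat !nth_cat !size_map ik lt_min.
      by move=> /(_ (leq_trans ik (leq_addr _ _)))/andP[].
    have := hy (size fs + i)%N; rewrite ltn_add2l => /(_ ik).
    rewrite /functional_seq /= !map_cat !nth_cat !size_map ltnNge leq_addr /=.
    by rewrite addKn lt_min; case/andP.
  - by exists fs, e; split=> // y /h; exact: W12.
split=> //; apply/cvg_sup => f; apply: cvg_initial.
apply/cvgrPdist_lt => e e0; exists [:: f], e; split=> // y /(_ 0%N isT) /=.
by rewrite distrC.
Qed.

Lemma continuous_weak (f : continuous_functional V) :
  continuous (sval f : weak_space V -> R).
Proof.
move=> x U xU.
have /cvg_sup/(_ f) : nbhs (x : weak_space V) --> x by exact: cvg_id.
by apply; exact: (@initial_continuous _ _ (sval f : V -> R)).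
Qed.

(* [h] encodes the sequence of functionals [fun x => h (i, x)], so that a single
   product space carries all the finite powers of the dual ball. *)
Definition functional_ball n : set {ptws nat * V -> R} :=
  [set h | (forall i a x y, h (i, a *: x + y) = a * h (i, x) + h (i, y)) /\
    forall i x, `|h (i, x)| <= n%:R * `|x|].

(** The Banach-Alaoglu argument: the linearity equations are closed conditions inside a Tychonoff
    product of segments. *)
Lemma compact_functional_ball n : compact (functional_ball n).
Proof.
pose box : set {ptws nat * V -> R} :=
  [set h | forall p, `[- (n%:R * `|p.2|), n%:R * `|p.2|]%classic (h p)].
have cbox : compact box.
  exact: (@tychonoff (nat * V)%type (fun=> R)
    (fun p => `[- (n%:R * `|p.2|), n%:R * `|p.2|]%classic)
    (fun p => @segment_compact _ _ _)).
pose C (p : nat * R * V * V) : set {ptws nat * V -> R} :=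
  [set h | h (p.1.1.1, p.1.1.2 *: p.1.2 + p.2) =
    p.1.1.2 * h (p.1.1.1, p.1.2) + h (p.1.1.1, p.2)].
have clC : closed (\bigcap_p C p).
  by apply: closed_bigI => p _; apply: closed_eq_affine; exact: continuous_eval.
suff -> : functional_ball n = box `&` \bigcap_p C p by exact: compact_closedI.
apply/seteqP; split=> [h [hlin hn]|h [hbox hlin]].
  split=> [[i x]|[[[i a] x] y] _]; last by rewrite /C /= hlin.
  by rewrite /= in_itv /= -ler_norml.
split=> [i a x y|i x]; last first.
  by have := hbox (i, x); rewrite /= in_itv /= -ler_norml.
exact: (hlin (i, a, x, y) I).
Qed.

Lemma functional_ball_functional n h i : functional_ball n h ->
  exists f : continuous_functional V, forall x, sval f x = h (i, x).
Proof.
move=> [hlin hn].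
pose g x : R := h (i, x).
have glin : linear_for *%R g by move=> a x y; exact: hlin.
pose gL := GRing.isLinear.Build R V R *%R g glin.
pose G : {scalar V} := HB.pack g gL.
have cG : continuous (G : V -> R).
  suff : bounded_near (G : {linear V -> R^o}) (nbhs (0 : V)).
    by move=> /linear_bounded_continuous.
  apply/linear_boundedP; exists n%:R.
  split=> [|r /ltW nr x]; first exact: num_real.
  by apply: (le_trans (hn i x)); exact: ler_wpM2r.
by exists (exist _ G cG).
Qed.

(* The compactness of the [n]-th power of the ball of radius [n] of the dual
   makes one finite [E] work for all its members. *)
Lemma weak_closure_finite A x n : closure (A : set (weak_space V)) x ->
  exists2 E, finite_set E /\ E `<=` A &
    forall h, functional_ball n h -> exists2 a, E a &
      forall i : 'I_n, `|h (val i, a) - h (val i, x)| < n.+1%:R^-1.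
Proof.
move=> Ax.
have FP := finite_subsets_filter_proper A.
pose P (E : set V) (h : {ptws nat * V -> R}) := exists2 a, E a &
  forall i : 'I_n, `|h (val i, a) - h (val i, x)| < n.+1%:R^-1.
have /compact_near_coveringP cpt := compact_functional_ball (n := n).
have [h Kh|E [fE EA] KE] := cpt _ (finite_subsets_filter A) P _; last first.
  by exists E => // h Kh; exact: (KE E).
have [f fE] := choice (fun i => functional_ball_functional i Kh).
pose W := [set y | forall i : 'I_n,
  `|sval (f (val i)) y - sval (f (val i)) x| < n.+1%:R^-1].
have xW : nbhs (x : weak_space V) W.
  apply: (@filter_forall (weak_space V) 'I_n (fun i y =>
    `|sval (f (val i)) y - sval (f (val i)) x| < n.+1%:R^-1) _
    (nbhs_filter (x : weak_space V))) => i.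
  apply: (@near_distr_lt R (weak_space V) _
    (cst (sval (f (val i)) x)) x n.+1%:R^-1) => /=.
  - exact: continuous_weak.
  - exact: cst_continuous.
  - by rewrite subrr normr0 invr_gt0.
have [a [Aa Wa]] := Ax _ xW.
(* The point [a] that works for [h] still works for all [k] near [h], since only finitely many
   evaluations are involved, and for all [E] containing [a]. *)
exists ([set k | forall i : 'I_n, `|k (val i, a) - k (val i, x)| < n.+1%:R^-1],
  [set E | E a]) => /=; last by move=> [k E] [/= ka Ea]; exists a.
split; last exact: finite_subsets_filter_mem.
apply: (@filter_forall {ptws nat * V -> R} 'I_n (fun i k =>
  `|k (val i, a) - k (val i, x)| < n.+1%:R^-1) _ (nbhs_filter h)) => i.
apply: (@near_distr_lt R {ptws nat * V -> R} (fun k => k (val i, a))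
  (fun k => k (val i, x))); [exact: continuous_eval|exact: continuous_eval|].
by have := Wa i; rewrite !fE.
Qed.

Lemma functional_ball_seq fs :
  \forall n \near \oo, functional_ball n (functional_seq fs).
Proof.
elim: fs => [|f fs IH].
  near=> n; split=> [i a x y|i x]; rewrite /functional_seq /= !nth_nil.
    by rewrite mulr0 addr0.
  by rewrite normr0 mulr_ge0.
near=> n.
have [lin bnd] : functional_ball n (functional_seq fs) by near: n.
have fbnd x : `|sval f x| <= n%:R * `|x|.
  by move: x; near: n; exact: continuous_functional_bounded.
split=> [[|i] a x y|[|i] x].
- by rewrite /functional_seq /functional_val /= linearD linearZ.
- exact: (lin i).
- exact: fbnd.
- exact: (bnd i).
Unshelve. all: by end_near. Qed.

Lemma weak_countably_tight A x : closure (A : set (weak_space V)) x ->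
  exists2 A0, countable A0 /\ A0 `<=` A & closure (A0 : set (weak_space V)) x.
Proof.
move=> Ax; have /choice[E EP] n : exists E, (finite_set E /\ E `<=` A) /\
    forall h, functional_ball n h -> exists2 a, E a &
      forall i : 'I_n, `|h (val i, a) - h (val i, x)| < n.+1%:R^-1.
  by have [E ? ?] := weak_closure_finite n Ax; exists E.
exists (\bigcup_n E n).
  split; last by move=> y [n _ Eny]; exact: (EP n).1.2.
  by apply: bigcup_countable => // n _; exact: finite_set_countable (EP n).1.1.
move=> W /weak_nbhsE[fs [e [e0 We]]].
have einv : \forall n \near \oo, n.+1%:R^-1 < e.
  exact: near_infty_natSinv_lt (PosNum e0).
(* One [n] bounds the norms and the number of the functionals in [fs] and makes the tolerance
   smaller than [e], so [E n] meets [W]. *)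
have [n [[fsb ne] fsn]] := filter_ex (filterI (filterI
  (functional_ball_seq fs) einv) (nbhs_infty_ge (size fs))).
have [a Ea ha] := (EP n).2 _ fsb.
exists a; split; first by exists n.
apply: We => i ifs; have := ha (Ordinal (leq_trans ifs fsn)).
by move=> /lt_trans; exact.
Qed.
End weak_topology.

(** * Adequate families *)

Lemma eberlein_adequate_countable (R : realType) (V : normedModType R)
    (Y : Type) (D : set (set Y)) (A : set Y) :
  adequate D -> embeds (adequate_space D) (weak_space V) -> D A -> countable A.
Proof.
move=> [Dsub _] [e eemb] DA; have [einj econt eopen] := eemb.
have DAsub E : E `<=` A -> D E by exact: Dsub.
have charP E : E `<=` A -> [set char_fun E | E in D] (char_fun E).
  by move=> /DAsub DE; exists E.
(* Intersecting with [A] makes [E] a member of [D], so that [k] is total; for [E] inside [A] it is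
   [1_E]. *)
pose k (E : set Y) : adequate_space D :=
  SigSub (mem_set (charP (E `&` A) (@subIsetr _ E A))).
have kE E y : (set_val (k E) : {ptws Y -> bool}) y = `[< (E `&` A) y >] by [].
have FP := finite_subsets_filter_proper A.
have kA : k @ finite_subsets_filter A --> k A.
  apply: cvg_set_type_ptws => y; apply: cvg_near_cst.
  suff : \forall E \near finite_subsets_filter A, (E `&` A) y <-> (A `&` A) y.
    by apply: filterS => E; exact: asbool_equiv_eq.
  have [Ay|nAy] := pselect (A y).
    apply: filterS (finite_subsets_filter_mem Ay) => E Ey.
    by split=> -[].
  by apply: nearW => E; split=> -[].
have clA : closure ((e \o k) @` [set E | finite_set E /\ E `<=` A]
    : set (weak_space V)) (e (k A)).
  move=> U eU; have [E [fE EA] UE] := kA _ (econt _ _ eU).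
  by exists (e (k E)); split; [exists E|exact: UE].
have [A0 [cA0 A0sub] clA0] := weak_countably_tight clA.
have /choice[s sP] b :
    exists E, A0 b -> (finite_set E /\ E `<=` A) /\ e (k E) = b.
  have [A0b|nA0b] := pselect (A0 b); last by exists set0.
  by have [E fE <-] := A0sub b A0b; exists E.
apply: (@sub_countable _ _ _ (\bigcup_(b in A0) s b)); last first.
  apply: bigcup_countable => // b /sP[[fE _] _].
  exact: finite_set_countable.
apply: subset_card_le => y Ay.
(* The functions with value 1 at [y] form an open set containing [1_A]. Its image is the trace of a
   weakly open [W], which [A0] must meet, so [y] lies in some [s b]. *)
pose U : set (adequate_space D) :=
  (fun r => (set_val r : {ptws Y -> bool}) y) @^-1` [set true].
have oU : open U.
  have /continuousP := @continuous_set_type_eval Y bool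
    [set char_fun E | E in D] y.
  by apply; exact: discrete_open.
have [W oW eUW] := eopen U oU.
have UkA : (e @` U) (e (k A)).
  by exists (k A) => //; rewrite /U /= kE; exact/asboolP.
have [b [A0b Wb]] : A0 `&` W !=set0.
  apply: clA0; apply: open_nbhs_nbhs; split=> //.
  by move: UkA; rewrite eUW => -[].
exists b => //; have [_ kb] := sP b A0b.
have : (e @` U) b by rewrite eUW; split=> //; exists (k (s b)).
move=> [r Ur rb]; have re : r = k (s b) by apply: einj; rewrite rb kb.
by move: Ur; rewrite re /U /= kE => /asboolP[].
Qed.

Lemma adequate_eberlein_omega1_sequentially_compact (R : realType) (Y : Type)
    (D : set (set Y)) :
  adequate D -> eberlein_compact R (adequate_space D) ->
  omega1_sequentially_compact (adequate_space D).
Proof.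
move=> adD [cptD [V emb]].
apply: (@compact_countable_support_omega1_sequentially_compact
  (adequate_space D) bool Y (fun s => set_val s : Y -> bool) false) => //.
- exact: second_countable_bool.
- exact: hausdorff_accessible discrete_hausdorff.
- exact: continuous_set_type_eval.
- by move=> F x FF Fx; apply: cvg_set_type_ptws.
- move=> x; have [A DA Ax] := set_valP x.
  apply: sub_countable (eberlein_adequate_countable adD emb DA).
  have xE : set_val x = char_fun A by [].
  apply: subset_card_le => y /=; rewrite xE => /eqP.
  by rewrite eqbF_neg negbK => /asboolP.
Qed.

Theorem theorem4p11 (R : realType) :
  (forall X : topologicalType,
     sequentially_compact X -> strongly_monolithic X ->
     omega1_sequentially_compact X) /\
  (forall X : topologicalType,
     corson_compact R X -> omega1_sequentially_compact X) /\
  (forall (Y : Type) (D : set (set Y)),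
     adequate D -> eberlein_compact R (adequate_space D) ->
     omega1_sequentially_compact (adequate_space D)).
Proof.
split; first exact: monolithic_omega1_sequentially_compact.
split; first exact: corson_compact_omega1_sequentially_compact.
exact: adequate_eberlein_omega1_sequentially_compact.
Qed.
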